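(* Let $\mathcal{Y}\subset\mathbb{R}^n$, let $\mathbf{\Phi}:\mathcal{Y}\to I(\mathbb{R})$ be an interval-valued function and let $u\in\mathcal{Y}$. If the $gH$-weak subdifferential $\partial^w\mathbf{\Phi}(u)$ is nonempty, then $\partial^w\mathbf{\Phi}(u)$ is convex.
   Context: $I(\mathbb{R})$ is the set of compact intervals $\mathbf{X}=[\underline{x},\overline{x}]$, $\underline{x}\le\overline{x}$; a real number $c$ is identified with $[c,c]$. Operations: $\mathbf{X}\oplus\mathbf{Y}=[\underline{x}+\underline{y},\overline{x}+\overline{y}]$; $\lambda\odot\mathbf{X}=[\min\{\lambda\underline{x},\lambda\overline{x}\},\max\{\lambda\underline{x},\lambda\overline{x}\}]$ for $\lambda\in\mathbb{R}$; $gH$-difference $\mathbf{X}\ominus_{gH}\mathbf{Y}=[\min\{\underline{x}-\underline{y},\overline{x}-\overline{y}\},\max\{\underline{x}-\underline{y},\overline{x}-\overline{y}\}]$. Order: $\mathbf{X}\preceq\mathbf{Y}$ iff $\underline{x}\le\underline{y}$ and $\overline{x}\le\overline{y}$. For $\widehat{\mathbf{G}}=(\mathbf{G}_1,\dots,\mathbf{G}_n)\in I(\mathbb{R})^n$ and $d\in\mathbb{R}^n$, $\widehat{\mathbf{G}}^\top\odot d=\bigoplus_{i=1}^n d_i\odot\mathbf{G}_i$. Operations $\oplus$, $\lambda\odot$ on $I(\mathbb{R})^n$ are componentwise. $\mathbb{R}_+=[0,\infty)$ and $\|\cdot\|$ is the Euclidean norm. The $gH$-weak subdifferential of $\mathbf{\Phi}$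 at $u\in\mathcal{Y}$ is $$\partial^w\mathbf{\Phi}(u)=\{(\widehat{\mathbf{G}},c)\in I(\mathbb{R})^n\times\mathbb{R}_+:\ \widehat{\mathbf{G}}^\top\odot(y-u)\ominus_{gH}c\|y-u\|\preceq\mathbf{\Phi}(y)\ominus_{gH}\mathbf{\Phi}(u)\ \ \forall y\in\mathcal{Y}\}.$$ A subset $S$ of $I(\mathbb{R})^n\times\mathbb{R}_+$ is convex if for all $(\widehat{\mathbf{G}}_1,c_1),(\widehat{\mathbf{G}}_2,c_2)\in S$ and $\beta\in[0,1]$ one has $(\beta\odot\widehat{\mathbf{G}}_1\oplus(1-\beta)\odot\widehat{\mathbf{G}}_2,\ \beta c_1+(1-\beta)c_2)\in S$. *)

(* Defs.v *)
From HB Require Import structures.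
From mathcomp Require Import all_boot all_order all_algebra.
From mathcomp Require Import all_classical all_reals.

Set Implicit Arguments.
Unset Strict Implicit.
Unset Printing Implicit Defensive.

Import Order.TTheory GRing.Theory Num.Theory.
Local Open Scope classical_set_scope.
Local Open Scope ring_scope.

(** A compact interval [inf X, sup X], encoded by its two endpoints. *)
Record cint (R : realType) := Cint {
  cinf : R;
  csup : R;
  cint_le : cinf <= csup }.

Section IntervalArithmetic.
Variable R : realType.
Implicit Types (X Y Z : cint R) (a b c : R).

Lemma cint_eq X Y : cinf X = cinf Y -> csup X = csup Y -> X = Y.
Proof.
case: X Y => [a b ab] [a' b' ab'] /= ea eb; subst a' b'.
by congr Cint; exact: bool_irrelevance.
Qed.

Definition cint_pt c : cint R := Cint (lexx c).

Lemma min_le_max a b : Num.min a b <= Num.max a b.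
Proof. by rewrite ge_min !le_max lexx. Qed.

Definition cint_hull a b : cint R := Cint (min_le_max a b).

Definition cint_add X Y : cint R := Cint (lerD (cint_le X) (cint_le Y)).

Definition cint_scale a X : cint R := cint_hull (a * cinf X) (a * csup X).

(** The gH-difference; unlike the Minkowski difference, it pairs the endpoints
    inf with inf and sup with sup. *)
Definition gH_sub X Y : cint R := cint_hull (cinf X - cinf Y) (csup X - csup Y).

Definition cint_preceq X Y : bool := (cinf X <= cinf Y) && (csup X <= csup Y).

Lemma cint_addA : associative cint_add.
Proof. by move=> X Y Z; apply: cint_eq; rewrite /= addrA. Qed.

Lemma cint_addC : commutative cint_add.
Proof. by move=> X Y; apply: cint_eq; rewrite /= addrC. Qed.

Lemma cint_add0 : left_id (cint_pt 0) cint_add.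
Proof. by move=> X; apply: cint_eq; rewrite /= add0r. Qed.

HB.instance Definition _ :=
  Monoid.isComLaw.Build (cint R) (cint_pt 0) cint_add
    cint_addA cint_addC cint_add0.

End IntervalArithmetic.

Section GHWeakSubdifferential.
Variables (R : realType) (n : nat).

(** The library norm on ['rV[R]_n] is the sup norm, hence this definition. *)
Definition enorm (d : 'rV[R]_n) : R := Num.sqrt (\sum_(i < n) d 0 i ^+ 2).

Definition cintv_add (G H : 'rV[cint R]_n) : 'rV[cint R]_n :=
  map2_mx (@cint_add R) G H.

Definition cintv_scale (a : R) (G : 'rV[cint R]_n) : 'rV[cint R]_n :=
  map_mx (cint_scale a) G.

Definition cint_dot (G : 'rV[cint R]_n) (d : 'rV[R]_n) : cint R :=
  \big[@cint_add R/cint_pt 0]_(i < n) cint_scale (d 0 i) (G 0 i).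

(** [Phi] is defined on the subtype of points of [Y] only. Subsets of
    I(R)^n x R_+ are represented as subsets of I(R)^n x R whose second
    components are nonnegative. *)
Definition gH_weak_subdiff (Y : set 'rV[R]_n) (Phi : Y -> cint R) (u : Y) :
    set ('rV[cint R]_n * R) :=
  [set p | 0 <= p.2 /\
    forall y : Y,
      cint_preceq
        (gH_sub (cint_dot p.1 (val y - val u))
                (cint_pt (p.2 * enorm (val y - val u))))
        (gH_sub (Phi y) (Phi u))].

Definition gH_convex (S : set ('rV[cint R]_n * R)) : Prop :=
  forall p q, S p -> S q -> forall b : R, 0 <= b <= 1 ->
    S (cintv_add (cintv_scale b p.1) (cintv_scale (1 - b) q.1),
       b * p.2 + (1 - b) * q.2).

End GHWeakSubdifferential.

(* Main.v *)
(** The condition at [y] says that the endpoints of [G^T (y - u)], both lowered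
    by [c * |y - u|], lie below those of the right-hand side, because subtracting
    a real number preserves the order of the endpoints.  It is thus preserved by
    convex combinations once [G |-> G^T d] commutes with them; this holds because
    scalar multiplication of intervals distributes over their sum (although
    [(a + b) X] differs from [a X + b X] in general). *)
Require Import Defs.
From mathcomp Require Import all_boot all_order all_algebra.
From mathcomp Require Import all_classical all_reals.
From mathcomp Require Import lra.
Import Order.TTheory GRing.Theory Num.Theory.
Local Open Scope classical_set_scope.
Local Open Scope ring_scope.

Section IntervalScaling.
Variable R : realType.
Implicit Types (a b c : R) (X Y Z : cint R).

Lemma cint_scale_ge0 a X : 0 <= a ->
  ((cinf (cint_scale a X) = (a * cinf X)%R) *
   (csup (cint_scale a X) = (a * csup X)%R))%type.
Proof.
move=> a0; have h : a * cinf X <= a * csup X by rewrite ler_wpM2l// cint_le.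
by split; rewrite /= ?(min_idPl h) ?(max_idPr h).
Qed.

Lemma cint_scale_le0 a X : a <= 0 ->
  ((cinf (cint_scale a X) = (a * csup X)%R) *
   (csup (cint_scale a X) = (a * cinf X)%R))%type.
Proof.
move=> a0; have h : a * csup X <= a * cinf X by rewrite ler_wnM2l// cint_le.
by split; rewrite /= ?(min_idPr h) ?(max_idPl h).
Qed.

(** The sign of [a] alone decides whether scaling keeps or swaps the endpoints, so [X], [Y] and
    their sum are treated alike. *)
Lemma cint_scaleD a X Y :
  cint_scale a (cint_add X Y) = cint_add (cint_scale a X) (cint_scale a Y).
Proof.
have [a0|/ltW a0] := leP 0 a.
  have E Z := cint_scale_ge0 a Z a0.
  by apply: cint_eq; rewrite E -[RHS]/(_ + _) !E -mulrDr.
have E Z := cint_scale_le0 a Z a0.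
by apply: cint_eq; rewrite E -[RHS]/(_ + _) !E -mulrDr.
Qed.

Lemma cint_scale_pt0 a : cint_scale a (cint_pt 0) = cint_pt 0.
Proof. by apply: cint_eq; rewrite /= mulr0 ?minxx ?maxxx. Qed.

(** A factor [b >= 0] comes out of the [min] and [max] that define scaling by [a], whatever the sign
    of [a]. *)
Lemma cint_scaleCA a b X : 0 <= b ->
  cint_scale a (cint_scale b X) = cint_scale b (cint_scale a X).
Proof.
move=> b0; have E Z := cint_scale_ge0 b Z b0.
apply: cint_eq; rewrite [RHS]E.
  by rewrite -[LHS]/(Num.min _ _) !E !(mulrCA a) -minr_pMr.
by rewrite -[LHS]/(Num.max _ _) !E !(mulrCA a) -maxr_pMr.
Qed.

Lemma gH_sub_ptE X c Z :
  cint_preceq (gH_sub X (cint_pt c)) Z =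
  (cinf X - c <= cinf Z) && (csup X - c <= csup Z).
Proof.
have h : cinf X - c <= csup X - c by rewrite lerD2r cint_le.
by rewrite /cint_preceq /= (min_idPl h) (max_idPr h).
Qed.

Lemma cint_dotD n (G H : 'rV[cint R]_n) (d : 'rV[R]_n) :
  cint_dot (cintv_add G H) d = cint_add (cint_dot G d) (cint_dot H d).
Proof.
by rewrite /cint_dot -big_split; apply: eq_bigr => i _; rewrite mxE cint_scaleD.
Qed.

Lemma cint_dotZ n b (G : 'rV[cint R]_n) (d : 'rV[R]_n) : 0 <= b ->
  cint_dot (cintv_scale b G) d = cint_scale b (cint_dot G d).
Proof.
move=> b0; rewrite /cint_dot.
rewrite (big_morph _ (cint_scaleD b) (cint_scale_pt0 b)).
by apply: eq_bigr => i _; rewrite mxE cint_scaleCA.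
Qed.

End IntervalScaling.

Theorem theorem1 (R : realType) (n : nat) (Y : set 'rV[R]_n)
    (Phi : Y -> cint R) (u : Y) :
  gH_weak_subdiff Phi u !=set0 -> gH_convex (gH_weak_subdiff Phi u).
Proof.
move=> _ [G c] [H e] [/= c0 Gc] [/= e0 He] b /andP[b0 b1].
have b1' : 0 <= 1 - b by rewrite subr_ge0.
split=> [|y] /=; first by rewrite addr_ge0// mulr_ge0.
move: (Gc y) (He y); rewrite !gH_sub_ptE cint_dotD !cint_dotZ//.
move=> /andP[Gi Gs] /andP[Hi Hs].
(* Serves both endpoints: [r] and [s] are the same endpoint of the products with [G] and [H], [t] is
   the norm of [y - u], and [z] is the matching endpoint of the right-hand side. *)
have conv (r s t w z : R) : r - c * t <= z -> s - e * t <= z ->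
    w = b * r + (1 - b) * s -> w - (b * c + (1 - b) * e) * t <= z.
  by move=> rz sz ->; have := ler_wpM2l b0 rz; have := ler_wpM2l b1' sz; lra.
apply/andP; split.
  (* The weights [b] and [1 - b] are nonnegative, so scaling by them swaps no endpoints. *)
  by apply: conv Gi Hi _; rewrite -[LHS]/(_ + _) !cint_scale_ge0.
by apply: conv Gs Hs _; rewrite -[LHS]/(_ + _) !cint_scale_ge0.
Qed.
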